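(* Let $U=\{e_1,\dots,e_n\}$ and let $\pi,\sigma$ be two rankings of $U$. Then $\mathcal{LR}(\pi,\sigma)=\mathcal{F}(\pi,\sigma)$, where $\mathcal{F}(\pi,\sigma)=\sum_{e\in U}|\pi(e)-\sigma(e)|$ is Spearman's footrule distance and $\mathcal{LR}$ is the LR-distance defined below.
   Context: A ranking of a finite set $U$ with $|U|=n$ is a bijection $\pi:U\to\{1,\dots,n\}$; $\pi(e)$ is the rank of $e$, and the elements listed in increasing rank are $\prec e^\pi_1,\dots,e^\pi_n\succ$. For a ranking $\sigma$, an integer interval $I$ and $e\in U$, let $p(e)^I_\sigma=1$ if $\sigma(e)\in I$ and $0$ otherwise. For $1\le a\le b\le n$, the subranking of $\pi$ with rank interval $[a:b]$ is the consecutive subsequence of $\pi$ consisting of the elements $e$ with $\pi(e)\in[a:b]$. LR-distance: for a subranking $\tau$ of $\pi$ with rank interval $[a:b]$, define $\mathcal{LR}(\tau,\sigma)=0$ if $a\ge b$ (i.e. $\tau$ has at most one element), and otherwise, with $h=\lfloor (a+b)/2\rfloor$, letting $\tau_\ell$ and $\tau_r$ be the subrankings of $\pi$ with rank intervals $[a:h]$ and $[h+1:b]$, $$\mathcal{LR}(\tau,\sigma)=\sum_{e:\ \pi(e)\in[1:h]} p(e)^{[h+1:n]}_\sigma+\mathcal{LR}(\tau_\ell,\sigma)+\sum_{e:\ \pi(e)\in[h+1:n]} p(e)^{[1:h]}_\sigma+\mathcal{LR}(\tau_r,\sigma).$$ (Here $[1:h]$ and $[h+1:n]$ are the left-extended interval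 of $\tau_\ell$ and the right-extended interval of $\tau_r$ with respect to $\pi$.) Finally $\mathcal{LR}(\pi,\sigma)$ is this quantity for $\tau=\pi$, i.e. rank interval $[1:n]$. *)

(* Defs.v *)
From mathcomp Require Import all_boot all_order all_algebra.
From mathcomp Require Import zify.

Set Implicit Arguments.
Unset Strict Implicit.
Unset Printing Implicit Defensive.

Section Rankings.
Variable U : finType.
Implicit Types (pi sigma : U -> nat) (a b h i j k : nat).

(* Ranks are 1-based: [pi] is a bijection from U onto {1, ..., #|U|}. *)
Definition is_ranking pi : Prop :=
  [/\ forall e, 1 <= pi e <= #|U|,
      injective pi &
      forall k, 1 <= k <= #|U| -> exists e, pi e = k].

Definition rank_in sigma i j (e : U) : nat := i <= sigma e <= j.

(* A subranking of [pi] is represented by its rank interval [a:b].           *)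
(* Both halves of [a:b] are strictly shorter than [a:b] when a < b, so       *)
(* fuel b - a is always sufficient: see [LR_subE] for the actual recursion.  *)
Fixpoint LR_fuel pi sigma (fuel a b : nat) : nat :=
  if fuel is fuel'.+1 then
    if b <= a then 0 else
    let h := (a + b) %/ 2 in
    \sum_(e : U | 1 <= pi e <= h) rank_in sigma h.+1 #|U| e
    + LR_fuel pi sigma fuel' a h
    + \sum_(e : U | h.+1 <= pi e <= #|U|) rank_in sigma 1 h e
    + LR_fuel pi sigma fuel' h.+1 b
  else 0.

Definition LR_sub pi sigma a b : nat := LR_fuel pi sigma (b - a) a b.

Definition LR pi sigma : nat := LR_sub pi sigma 1 #|U|.

Definition footrule pi sigma : nat := \sum_(e : U) `|pi e - sigma e|%N.

Lemma LR_fuel_enough pi sigma k1 k2 a b :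
  b - a <= k1 -> b - a <= k2 ->
  LR_fuel pi sigma k1 a b = LR_fuel pi sigma k2 a b.
Proof.
elim: k1 k2 a b => [|k1 IH] [|k2] a b //= H1 H2; case: leqP => // Hab; try lia.
rewrite (IH k2 a); try lia.
by rewrite (IH k2 _ b); lia.
Qed.

Lemma LR_subE pi sigma a b :
  LR_sub pi sigma a b =
    if b <= a then 0 else
    let h := (a + b) %/ 2 in
    \sum_(e : U | 1 <= pi e <= h) rank_in sigma h.+1 #|U| e
    + LR_sub pi sigma a h
    + \sum_(e : U | h.+1 <= pi e <= #|U|) rank_in sigma 1 h e
    + LR_sub pi sigma h.+1 b.
Proof.
rewrite /LR_sub; case Ek: (b - a) => [|k] /=; case: leqP => // Hab; first lia.
rewrite (@LR_fuel_enough _ _ k ((a + b) %/ 2 - a) a); try lia.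
by rewrite (@LR_fuel_enough _ _ k (b - ((a + b) %/ 2).+1) _ b); lia.
Qed.

End Rankings.

(* Main.v *)
Require Import Defs.
From mathcomp Require Import all_boot all_order all_algebra.
From mathcomp Require Import zify.

(** The recursion splits the rank interval [[a:b]] at [h], then [[a:h]] and
    [[h+1:b]], so every cut [h] with [a <= h < b] is used exactly once. Hence
    the LR-distance counts the pairs (element, cut) such that the cut separates
    the two ranks of the element, and an element [e] is separated by exactly
    [|pi e - sigma e|] cuts. *)

Definition cut_crossings {U : finType} (pi sigma : U -> nat) (h : nat) : nat :=
  \sum_(e : U | 1 <= pi e <= h) rank_in sigma h.+1 #|U| e
  + \sum_(e : U | h.+1 <= pi e <= #|U|) rank_in sigma 1 h e.

Lemma LR_sub_sum_cuts (U : finType) (pi sigma : U -> nat) (a b : nat) :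
  LR_sub pi sigma a b = \sum_(a <= h < b) cut_crossings pi sigma h.
Proof.
have [k le_k] := ubnP (b - a); elim: k a b le_k => // k IH a b le_k.
rewrite LR_subE; case: leqP => [le_ba|lt_ab]; first by rewrite big_geq.
set h := (a + b) %/ 2; cbv zeta.
have le_ah : a <= h by rewrite /h; lia.
have lt_hb : h < b by rewrite /h; lia.
rewrite !IH; try lia.
rewrite (@big_cat_nat _ _ _ h a b) //=; last exact: ltnW.
(* The cut [h] itself is the top-level term of the recursion; [h.+1] to [b] remains for the right
   half. *)
rewrite [\sum_(h <= _ < b) _]big_ltn //.
rewrite [cut_crossings _ _ h]/cut_crossings !addnA.
by congr (_ + _ + _); exact: addnC.
Qed.

(** This counts the intersection of two half-open intervals; truncated subtraction covers the empty
    case. *)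
Lemma sum_nat_indicator (m n i j : nat) :
  \sum_(m <= h < n) (i <= h < j : nat) = minn j n - maxn i m.
Proof.
elim: n => [|n IH]; first by rewrite big_geq //; lia.
case: (leqP m n) => le_mn; first by rewrite big_nat_recr //= IH; lia.
by rewrite big_geq //; lia.
Qed.

Lemma cut_crossingsE (U : finType) (pi sigma : U -> nat) (h : nat) :
  (forall e, 1 <= pi e <= #|U|) -> (forall e, 1 <= sigma e <= #|U|) ->
  cut_crossings pi sigma h =
  \sum_(e : U) ((pi e <= h < sigma e : nat) + (sigma e <= h < pi e : nat)).
Proof.
move=> pi_bd sigma_bd; rewrite /cut_crossings big_split /=.
congr (_ + _); rewrite big_mkcond; apply: eq_bigr => e _;
  move: (pi_bd e) (sigma_bd e); rewrite /rank_in;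
  move: (pi e) (sigma e) #|U| => p s n; case: ifP; lia.
Qed.

Theorem theorem1 (U : finType) (pi sigma : U -> nat)
    (hpi : is_ranking pi) (hsigma : is_ranking sigma) :
  LR pi sigma = footrule pi sigma.
Proof.
case: hpi hsigma => pi_bd _ _ [sigma_bd _ _].
rewrite /LR /footrule LR_sub_sum_cuts.
under eq_bigr => h _ do rewrite (cut_crossingsE _ _ _ _ pi_bd sigma_bd).
rewrite exchange_big /=; apply: eq_bigr => e _.
rewrite big_split /= !sum_nat_indicator.
(* Ranks lie in [[1, n]], so clamping leaves [(s - p) + (p - s)] in truncated subtraction, which is
   the absolute difference. *)
by move: (pi_bd e) (sigma_bd e); move: (pi e) (sigma e) #|U| => p s n; lia.
Qed.
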